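(* Let $\mathbf{A}\in\mathbb{R}^{l\times l}$ have only real and discrete (i.e. algebraically simple) eigenvalues $\lambda_1,\dots,\lambda_l$, all satisfying $|\lambda_i|>\delta\gg\varepsilon$ for some positive $\delta$, and let $\mathbf{g},\mathbf{c}\in\mathbb{R}^l$ be constant vectors. Let $(\mathbf{U},B)$ solve $$\mathbf{U}_t+\mathbf{A}\mathbf{U}_x=-\mathbf{g}B_x,\qquad B_t+\varepsilon\,\mathbf{c}^T\mathbf{U}_x=0,\qquad x\in\mathbb{R},\ t\ge0,$$ and let $B^{(1)}$ solve the first order model $$B^{(1)}_t+\varepsilon\lambda_B^{(1)}B^{(1)}_x=0,\qquad \lambda_B^{(1)}=\lambda_B^{(0)}-\varepsilon\lambda_B^{(0)}\,\mathbf{c}^T\mathbf{A}^{-2}\mathbf{g},\qquad \lambda_B^{(0)}=-\mathbf{c}^T\mathbf{A}^{-1}\mathbf{g}.$$ Assume the initial data satisfy 1. $(\mathbf{A}+\varepsilon\mathbf{X}^{-1}\mathbf{\Lambda}\hat{\mathbf{X}})\mathbf{U}_x(x,0)+(\mathbf{g}+\varepsilon\mathbf{X}^{-1}\mathbf{\Lambda}\hat{\boldsymbol{\alpha}})B_x(x,0)=\mathcal{O}(\varepsilon^2)$; 2. $\mathbf{A}\mathbf{U}_{xx}(x,0)+\mathbf{g}B_{xx}(x,0)=\mathcal{O}(\varepsilon)$; 3. $B^{(1)}(x,0)=B(x,0)\in W^{2,\infty}(\mathbb{R})$. Then $$\|B(x,t)-B^{(1)}(x,t)\|_\infty=\mathcal{O}(\varepsilon^2)\qquad\text{for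 } t\sim\mathcal{O}(\varepsilon^{-1}).$$
   Context: Here $\mathbf{U}$ takes values in $\mathbb{R}^l$ (fast variables), $B$ and $B^{(1)}$ are real-valued, and $\varepsilon>0$ is a small parameter. The quantities $l,\mathbf{A},\mathbf{g},\mathbf{c},\delta$ are fixed, independent of $\varepsilon$; the solutions and the initial data may depend on $\varepsilon$, with the $W^{2,\infty}$ norm of $B(\cdot,0)$ bounded uniformly in $\varepsilon$. $t$ is the fast time and $\tau=\varepsilon t$ the slow time; in slow time the first order model reads $B^{(1)}_\tau+\lambda_B^{(1)}B^{(1)}_x=0$, and $B^{(1)}(x,t)$ denotes its value at slow time $\tau=\varepsilon t$. Spectral notation: $\mathbf{A}=\mathbf{X}^{-1}\mathbf{\Lambda}\mathbf{X}$ with $\mathbf{\Lambda}=\mathrm{diag}\{\lambda_1,\dots,\lambda_l\}$. The matrix $\mathbf{C}^\varepsilon=\begin{pmatrix}\mathbf{A}&\mathbf{g}\\ \varepsilon\mathbf{c}^T&0\end{pmatrix}$ is, for small $\varepsilon$, diagonalized as $\mathbf{C}^\varepsilon=(\mathbf{K}^\varepsilon)^{-1}\mathbf{D}^\varepsilon\mathbf{K}^\varepsilon$ with $$\mathbf{K}^\varepsilon=\begin{pmatrix}\mathbf{X}+\varepsilon\hat{\mathbf{X}}&\mathbf{\Lambda}^{-1}\mathbf{X}\mathbf{g}+\varepsilon\hat{\boldsymbol{\alpha}}\\ \varepsilon\hat{\boldsymbol{\beta}}^T&1+\varepsilon\hat{\theta}\end{pmatrix},\qquad \mathbf{D}^\varepsilon=\begin{pmatrix}\mathbf{\Lambda}+\varepsilon\hat{\mathbf{\Lambda}}&0\\0&\varepsilon\mu\end{pmatrix},$$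 where $\hat{\mathbf{\Lambda}}$ is diagonal and $\hat{\mathbf{X}}\in\mathbb{R}^{l\times l}$, $\hat{\boldsymbol{\alpha}},\hat{\boldsymbol{\beta}}\in\mathbb{R}^l$, $\hat{\theta},\mu\in\mathbb{R}$, $\hat{\mathbf{\Lambda}}$ (possibly depending on $\varepsilon$) remain bounded as $\varepsilon\to0$ (perturbation theory of simple eigenvalues and eigenvectors). This defines $\hat{\mathbf{X}}$ and $\hat{\boldsymbol{\alpha}}$. $\|\cdot\|_\infty$ is the supremum norm in $x\in\mathbb{R}$. $\mathcal{O}(\varepsilon^k)$ for functions means bounded in supremum norm over $x\in\mathbb{R}$ by a constant (independent of $\varepsilon$) times $\varepsilon^k$ as $\varepsilon\to0$. ''For $t\sim\mathcal{O}(\varepsilon^{-1})$'' means: for every fixed $T>0$, uniformly for $0\le t\le T/\varepsilon$. *)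

(* Defs.v *)
From HB Require Import structures.
From mathcomp Require Import all_boot all_order all_algebra.
From mathcomp Require Import all_classical all_reals all_analysis.

Set Implicit Arguments.
Unset Strict Implicit.
Unset Printing Implicit Defensive.

Import Order.TTheory GRing.Theory Num.Theory.
Import numFieldNormedType.Exports.

Local Open Scope classical_set_scope.
Local Open Scope ring_scope.

Section Sobolev.
Context {R : realType}.
Implicit Types f g phi : R -> R.

(* C_c^oo(R) *)
Definition test_function phi : Prop :=
  (forall (n : nat) (x : R), derivable (derive1n n phi) x 1) /\
  compact (closure [set x | phi x != 0]).

Definition weak_deriv (k : nat) f g : Prop :=
  [/\ locally_integrable [set: R] f,
      locally_integrable [set: R] g &
      forall phi, test_function phi ->
        Rintegral (@lebesgue_measure R) setT (fun x => f x * derive1n k phi x) =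
        (-1) ^+ k * Rintegral (@lebesgue_measure R) setT (fun x => g x * phi x)].

Definition Linf_norm (V : normedModType R) (F : R -> V) : \bar R :=
  Lnorm (@lebesgue_measure R) +oo%E (fun x => `|F x|%:E).

(* f belongs to W^{m,oo}(R) with norm (the sum over k <= m of the L^oo norms
   of the k-th weak derivatives) at most M. *)
Definition sobolev_inf_norm_le (m : nat) f (M : R) : Prop :=
  exists2 d : nat -> R -> R,
    (forall k, (k <= m)%N -> weak_deriv k f (d k)) &
    (\sum_(k < m.+1) Linf_norm (d k) <= M%:E)%E.

(* A family F e of functions on R, defined almost everywhere, is O(e ^ k) in
   the L^oo norm as e -> 0+. *)
Definition Linf_bigO (V : normedModType R) (F : R -> R -> V) (k : nat) : Prop :=
  exists C : R, \forall e \near 0^'+,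
    (Linf_norm (F e) <= (C * e ^+ k)%:E)%E.

Definition sup_norm f : \bar R := ereal_sup (range (fun x => `|f x|%:E)).

End Sobolev.

Section Spectral.
Context {R : realType} {l : nat}.

Definition simple_real_spectrum (A : 'M[R]_l) (lambda : 'rV[R]_l) : Prop :=
  char_poly A = \prod_(i < l) ('X - (lambda 0 i)%:P) /\
  injective (fun i => lambda 0 i).

Definition C_mx (A : 'M[R]_l) (g c : 'cV[R]_l) (e : R) : 'M[R]_(l + 1) :=
  block_mx A g (e *: c^T) 0.

Definition K_mx (X : 'M[R]_l) (lambda : 'rV[R]_l) (g : 'cV[R]_l)
    (Xh : 'M[R]_l) (alphah betah : 'cV[R]_l) (thetah e : R) : 'M[R]_(l + 1) :=
  block_mx (X + e *: Xh) (invmx (diag_mx lambda) *m X *m g + e *: alphah)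
           (e *: betah^T) (1 + e * thetah)%:M.

Definition D_mx (lambda lambdah : 'rV[R]_l) (mu e : R) : 'M[R]_(l + 1) :=
  block_mx (diag_mx lambda + e *: diag_mx lambdah) 0 0 (e * mu)%:M.

Definition lambdaB0 (A : 'M[R]_l) (g c : 'cV[R]_l) : R :=
  - (c^T *m invmx A *m g) 0 0.

Definition lambdaB1 (A : 'M[R]_l) (g c : 'cV[R]_l) (e : R) : R :=
  lambdaB0 A g c
  - e * lambdaB0 A g c * (c^T *m (invmx A *m invmx A) *m g) 0 0.

End Spectral.

Section Solutions.
Context {R : realType}.

(* Regularity of a classical solution on R x [0, +oo[: continuity up to the
   initial line, and Fréchet differentiability in (x, t) for t > 0 (in
   particular every function that is C^1 up to t = 0 qualifies). *)
Definition classical_regularity (V : normedModType R) (u : R -> R -> V) : Prop :=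
  {within [set p : R * R | 0 <= p.2], continuous (fun p => u p.1 p.2)} /\
  forall x t : R, 0 < t -> differentiable (fun p : R * R => u p.1 p.2) (x, t).

Definition dx (V : normedModType R) (u : R -> R -> V) (x t : R) : V :=
  derive1 (fun y => u y t) x.

Definition dt (V : normedModType R) (u : R -> R -> V) (x t : R) : V :=
  derive1 (fun s => u x s) t.

Definition solves_system (l : nat) (A : 'M[R]_l) (g c : 'cV[R]_l) (e : R)
    (U : R -> R -> 'cV[R]_l) (B : R -> R -> R) : Prop :=
  [/\ classical_regularity U, classical_regularity B &
      forall x t : R, 0 < t ->
        dt U x t + A *m dx U x t = - (dx B x t *: g) /\
        dt B x t + e * (c^T *m dx U x t) 0 0 = 0].

Definition solves_transport (v : R) (B : R -> R -> R) : Prop :=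
  classical_regularity B /\
  forall x t : R, 0 < t -> dt B x t + v * dx B x t = 0.

End Solutions.

(* Main.v *)
Require Import Defs.
From HB Require Import structures.
From mathcomp Require Import all_boot all_order all_algebra.
From mathcomp Require Import all_classical all_reals all_analysis.
From mathcomp Require Import measurable_realfun ess_sup_inf ring lra.
Set Implicit Arguments.
Unset Strict Implicit.
Unset Printing Implicit Defensive.

Import Order.TTheory GRing.Theory Num.Theory.
Import numFieldNormedType.Exports.
Local Open Scope classical_set_scope.
Local Open Scope ring_scope.

(** Put [w := K (U, B)]. The relation [K C = D K] decouples the system: every
    component of [w] is transported with a constant speed, the fast ones with
    speeds of order one and the slow one with speed [e * mu].

    Let [(r, s)] be the last row of the inverse of [K], so that [B] is [r] times
    the fast components plus [s] times the slow one. At [e = 0] the matrix [K] is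
    block upper triangular, hence [r = O(e)] ([inverse_last_row_bound]). Up to
    the invertible factor [X^-1 Lambda], the first condition on the initial data
    says that the fast components start with slopes [O(e ^ 2)]
    ([fast_slope_factor]). Therefore [B (x, t)] and [B (x - e * mu * t, 0)], which
    differ only by [r] times increments of the fast components between points at
    distance [O(t) = O(1 / e)], are [O(e * e ^ 2 / e) = O(e ^ 2)] apart
    ([slow_variable_drift]).

    It remains to compare the speeds. The last row of [K C = D K] is a left
    eigenvector of [C]; eliminating its fast entries gives
    [mu = lambdaB1 + O(e ^ 2)] ([mu_expansion]). Up to time [T / e] the two
    characteristics thus separate by [O(e ^ 2)] only, and [B (., 0)] is Lipschitz
    because its weak derivative is bounded.

    The data are differentiable in the weak sense only, so both slope bounds
    rest on the fact that a continuous function whose weak derivative is bounded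
    by [L] almost everywhere is [L]-Lipschitz ([weak_deriv_lipschitz]). It
    follows by testing the weak derivative against smooth trapezoids, whose
    classical derivatives are differences of two approximate identities; these
    are built from [exp (- 1 / x)]. *)

(** * Smooth step functions *)

Section SmoothStep.
Context {R : realType}.
Implicit Types (f g : R -> R) (p : {poly R}) (x y : R).

(** The polynomial factor makes the family stable under differentiation: the
    derivative of [flat p] is [flat ('X^2 * (p - p^`()))]. The case [p = 1] is the
    classical function [exp (- 1 / x)] extended by zero. *)
Definition flat p x : R :=
  if 0 < x then p.[x^-1] * expR (- x^-1) else 0.

Lemma horner_le_expR p : exists K : R, forall y, 0 <= y -> `|p.[y]| <= K * expR y.
Proof.
exists (\sum_(i < size p) `|p`_i| * (i`!)%:R) => y y0.
rewrite horner_coef (le_trans (ler_norm_sum _ _ _))// mulr_suml ler_sum// => i _.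
rewrite normrM -mulrA ler_wpM2l// ger0_norm ?exprn_ge0//.
case: {i}(nat_of_ord i) => [|i].
  by rewrite expr0 mul1r -expR0 ler_expR.
have := expR_ge1Dxn i y0; rewrite -ler_pdivrMl ?ltr0n ?fact_gt0// mulrC.
by apply: le_trans; rewrite lerDr.
Qed.

(** Quadratic decay at [0] is what makes the two pieces of [flat p] fit together
    differentiably, with derivative [0] at the junction. *)
Lemma flat_le_sqr p : exists K : R, forall x, `|flat p x| <= K * x ^+ 2.
Proof.
have [K hK] := horner_le_expR ('X^2 * p); exists `|K| => x; rewrite /flat.
case: ifP => [x0|_]; last by rewrite normr0 mulr_ge0// sqr_ge0.
have x1 : 0 <= x^-1 by rewrite invr_ge0 ltW.
have := le_trans (hK _ x1) (ler_wpM2r (expR_ge0 _) (ler_norm K)).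
rewrite hornerM hornerXn normrM normrX (ger0_norm x1) exprVn.
rewrite mulrC ler_pdivrMr ?exprn_gt0// => h.
rewrite normrM (ger0_norm (expR_ge0 _)) expRN ler_pdivrMr ?expR_gt0//.
by rewrite mulrAC.
Qed.

(** At nonpositive [x], the bound of [flat_le_sqr] transfers to
    increments, so that [x = 0] and [x < 0] are handled at once. *)
Lemma is_derive_flat p x :
  is_derive x 1 (flat p) (flat ('X^2 * (p - p^`())) x).
Proof.
have [x0|x0] := ltP 0 x; last first.
  have [K hK] := flat_le_sqr p.
  have [flat0 ->] : flat p x = 0 /\ flat ('X^2 * (p - p^`())) x = 0.
    by rewrite /flat ltNge x0.
  have K0 : 0 <= K by have := hK 1; rewrite expr1n mulr1; exact: le_trans.
  have lim : (fun h => h^-1 *: (flat p (h *: (1 : R) + x) - flat p x)) @ 0^' --> (0 : R).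
    apply/cvgrPdist_le => /= e e0; near=> h.
    have hn0 : h != 0 by near: h; exact: nbhs_dnbhs_neq.
    rewrite sub0r normrN flat0 subr0 /GRing.scale/= mulr1.
    have : `|flat p (h + x)| <= K * h ^+ 2.
      have [hx|hx] := ltP 0 (h + x).
        rewrite (le_trans (hK _))// ler_wpM2l// ler_sqr ?nnegrE; lra.
      by rewrite {1}/flat ltNge hx/= normr0 mulr_ge0// sqr_ge0.
    rewrite normrM normfV ler_pdivrMl ?normr_gt0// => /le_trans; apply.
    rewrite -real_normK ?num_real// expr2 mulrA mulrC ler_wpM2l//.
    have : `|h| <= e / (K + 1).
      by near: h; apply: dnbhs0_le; rewrite divr_gt0// ltr_wpDl.
    move=> hh; apply: (@le_trans _ _ ((K + 1) * `|h|)).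
      by rewrite ler_wpM2r// lerDl.
    by rewrite mulrC -ler_pdivlMr// ltr_wpDl.
  by split; [apply: cvgP lim|exact: cvg_lim].
pose F := (fun y => horner p y^-1) * (fun y => expR (- y^-1)).
have xn0 : x != 0 by rewrite gt_eqF.
have dV : is_derive x 1 (fun y : R => y^-1) (- x ^- 2).
  split; first exact: derivableV.
  rewrite deriveV// (@derive_val _ _ _ _ _ _ _ (is_derive_id x (1 : R))).
  by rewrite /GRing.scale/= mulr1.
have dF : is_derive x 1 F (flat ('X^2 * (p - p^`())) x).
  have d1 := is_derive1_comp (is_derive_poly p x^-1) dV.
  have d2 := @is_derive1_comp R expR (fun y => - y^-1) x _ _
    (is_derive_expR (- x^-1)) (is_deriveN dV).
  apply: (is_derive_eq (is_deriveM d1 d2)).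
  rewrite /flat x0 /GRing.scale/= !hornerE/=.
  rewrite exprVn; ring.
apply: near_eq_is_derive dF; near=> y.
by rewrite /flat ifT//; near: y; exact: lt_nbhsr.
Unshelve. all: by end_near. Qed.

(** A class of functions closed under differentiation by construction, because
    the derivative of each constructor is again expressible by the
    constructors: smoothness of its members needs no formula for higher
    derivatives. *)
Inductive smooth_alg : (R -> R) -> Prop :=
| alg_flat p : smooth_alg (flat p)
| alg_cst a : smooth_alg (cst a)
| alg_add f g : smooth_alg f -> smooth_alg g -> smooth_alg (f + g)
| alg_mul f g : smooth_alg f -> smooth_alg g -> smooth_alg (f * g)
| alg_inv f : (forall x, f x != 0) -> smooth_alg f ->
    smooth_alg (fun x => (f x)^-1)
| alg_affine f a b : smooth_alg f -> smooth_alg (fun x => f (a * x + b)).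

Lemma is_derive_affine (a b x : R) : is_derive x 1 (fun y : R => a * y + b) a.
Proof.
have d := is_deriveD (is_deriveZ a (is_derive_id x (1 : R)))
  (is_derive_cst b x (1 : R)).
by apply: is_derive_eq d _; rewrite addr0 /GRing.scale/= mulr1.
Qed.

Lemma is_derive1E f f' : (forall x, is_derive x 1 f (f' x)) -> derive1 f = f'.
Proof. by move=> d; apply/funext => x; rewrite derive1E derive_val. Qed.

Lemma smooth_alg_derive f : smooth_alg f ->
  exists2 f', smooth_alg f' & forall x, is_derive x 1 f (f' x).
Proof.
elim=> {f}.
- move=> p; exists (flat ('X^2 * (p - p^`()))); first exact: alg_flat.
  by move=> x; exact: is_derive_flat.
- by move=> a; exists (cst 0); [exact: alg_cst|move=> x; exact: is_derive_cst].
- move=> f g _ [f' Sf' df] _ [g' Sg' dg].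
  by exists (f' + g'); [exact: alg_add|move=> x; exact: is_deriveD].
- move=> f g Sf [f' Sf' df] Sg [g' Sg' dg].
  exists (f * g' + g * f'); first by apply: alg_add; apply: alg_mul.
  by move=> x; exact: is_deriveM.
- move=> f f0 Sf [f' Sf' df].
  pose h := fun x => (f x)^-1.
  exists (cst (-1) * (h * h * f')).
    by do 2 ?apply: alg_mul => //; [exact: alg_cst|apply: alg_mul; exact: alg_inv].
  move=> x; split; first exact: derivableV.
  rewrite deriveV// (@derive_val _ _ _ _ _ _ _ (df x)) /GRing.scale/=.
  by rewrite -[RHS]/(-1 * (h x * h x * f' x)) /h -invfM -expr2 mulN1r mulNr.
- move=> f a b Sf [f' Sf' df].
  exists (cst a * (fun x => f' (a * x + b))).
    by apply: alg_mul; [exact: alg_cst|exact: alg_affine].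
  move=> x; rewrite [X in is_derive _ _ _ X]mulrC.
  exact: (is_derive1_comp (df _) (is_derive_affine a b x)).
Qed.

Lemma smooth_alg_derive1n f n : smooth_alg f -> smooth_alg (derive1n n f).
Proof.
move=> Sf; elim: n => [//|n]; rewrite derive1nS => /smooth_alg_derive[f' Sf' d].
by rewrite (is_derive1E d).
Qed.

Lemma smooth_alg_smooth f : smooth_alg f ->
  forall (n : nat) x, derivable (derive1n n f) x 1.
Proof.
move=> Sf n x.
by have [f' _ /(_ x)[]] := smooth_alg_derive (smooth_alg_derive1n n Sf).
Qed.

Definition step_denom x : R := flat 1 x + flat 1 (- x + 1).

(** The two terms of [step_denom] never vanish together, and the second one
    vanishes for [x >= 1], whence a smooth passage from [0] to [1] over the
    unit interval. *)
Definition step x : R := flat 1 x / step_denom x.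

Lemma flat1_gt0 x : 0 < x -> 0 < flat 1 x.
Proof. by move=> x0; rewrite /flat x0 hornerC mul1r expR_gt0. Qed.

Lemma flat_le0 p x : x <= 0 -> flat p x = 0.
Proof. by rewrite /flat leNgt => /negbTE ->. Qed.

Lemma flat1_ge0 x : 0 <= flat 1 x.
Proof. by have [/flat1_gt0/ltW//|/flat_le0->] := ltP 0 x. Qed.

Lemma step_denom_gt0 x : 0 < step_denom x.
Proof.
rewrite /step_denom; have [x0|x0] := ltP 0 x.
  by rewrite ltr_pwDl ?flat1_gt0 ?flat1_ge0.
by rewrite ltr_wpDl ?flat1_gt0 ?flat1_ge0//; lra.
Qed.

Lemma smooth_alg_step : smooth_alg step.
Proof.
apply: alg_mul; first exact: alg_flat.
apply: alg_inv; first by move=> x; rewrite gt_eqF ?step_denom_gt0.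
apply: alg_add; first exact: alg_flat.
rewrite (_ : (fun x => _) = (fun x => flat 1 (-1 * x + 1))).
  by apply: alg_affine; exact: alg_flat.
by apply/funext => x; rewrite mulN1r.
Qed.

Lemma step_le0 x : x <= 0 -> step x = 0.
Proof. by move=> x0; rewrite /step flat_le0// mul0r. Qed.

Lemma step_ge1 x : 1 <= x -> step x = 1.
Proof.
move=> x1; have := step_denom_gt0 x; rewrite /step /step_denom.
rewrite (@flat_le0 _ (- x + 1)) ?addr0; last by lra.
by move=> /gt_eqF/negbT/divff.
Qed.

Definition dstep : R -> R := derive1 step.

Lemma is_derive_step x : is_derive x 1 step (dstep x).
Proof.
have [f' _ df] := smooth_alg_derive smooth_alg_step.
by rewrite /dstep (is_derive1E df).
Qed.

Lemma smooth_alg_dstep : smooth_alg dstep.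
Proof. exact: (@smooth_alg_derive1n step 1 smooth_alg_step). Qed.

(** The quotient rule leaves in the numerator
    [flat 1 x * flat 'X^2 (1 - x) + flat 1 (1 - x) * flat 'X^2 x], a sum of
    products of nonnegative terms. *)
Lemma dstep_ge0 x : 0 <= dstep x.
Proof.
have d1 := is_derive_flat 1 x.
have d2 : is_derive x 1 (fun y => flat 1 (- y + 1)) (- flat 'X^2 (- x + 1)).
  have -> : (fun y => flat 1 (- y + 1)) = flat 1 \o (fun y => -1 * y + 1).
    by apply/funext => y /=; rewrite mulN1r.
  have d := @is_derive1_comp R (flat 1) (fun y => -1 * y + 1) x _ _
    (is_derive_flat 1 (-1 * x + 1)) (is_derive_affine (-1) 1 x).
  by apply: is_derive_eq d _; rewrite derivC subr0 mulr1 mulrN1 mulN1r.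
have D0 := step_denom_gt0 x.
have dD : is_derive x 1 step_denom (flat 'X^2 x - flat 'X^2 (- x + 1)).
  by apply: is_derive_eq (is_deriveD d1 d2) _; rewrite derivC subr0 mulr1.
have dV : is_derive x 1 (fun y => (step_denom y)^-1)
   (- (step_denom x) ^- 2 * (flat 'X^2 x - flat 'X^2 (- x + 1))).
  have Dn0 : step_denom x != 0 by rewrite gt_eqF.
  split; first by apply: (@derivableV _ _ step_denom).
  by rewrite (deriveV Dn0)// (@derive_val _ _ _ _ _ _ _ dD).
have dS := is_deriveM d1 dV.
rewrite /dstep derive1E; case: dS => _ ->.
rewrite derivC subr0 mulr1 /GRing.scale/=.
have X2 y : 0 <= flat 'X^2 y.
  rewrite /flat; case: ifP => // y0; rewrite hornerXn.
  by rewrite mulr_ge0 ?expR_ge0// exprn_ge0// invr_ge0 ltW.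
set D := step_denom x in D0 *.
have -> : flat 1 x * (- D ^- 2 * (flat 'X^2 x - flat 'X^2 (- x + 1))) +
    D^-1 * flat 'X^2 x =
  D ^- 2 * (flat 1 x * flat 'X^2 (- x + 1) + flat 1 (- x + 1) * flat 'X^2 x).
  have -> : flat 1 (- x + 1) = D - flat 1 x by rewrite /D /step_denom addrAC subrr add0r.
  by field; rewrite gt_eqF.
by rewrite mulr_ge0 ?addr_ge0 ?mulr_ge0 ?X2 ?flat1_ge0// invr_ge0 sqr_ge0.
Qed.

Lemma step_bounds x : 0 <= step x <= 1.
Proof.
have D0 := step_denom_gt0 x; rewrite /step divr_ge0 ?flat1_ge0 ?(ltW D0)//=.
by rewrite ler_pdivrMr// mul1r lerDl flat1_ge0.
Qed.

Lemma step_homo x y : x <= y -> step x <= step y.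
Proof.
move=> xy.
have [|c _] := MVT_segment xy (fun z _ => is_derive_step z).
  apply/continuous_subspaceT => z.
  by apply/differentiable_continuous/derivable1_diffP; case: (is_derive_step z).
move=> e; rewrite -subr_ge0 e mulr_ge0 ?dstep_ge0 ?subr_ge0//.
Qed.

Lemma smooth_alg_continuous f : smooth_alg f -> continuous f.
Proof.
move=> Sf x; apply/differentiable_continuous/derivable1_diffP.
by have [f' _ /(_ x)[]] := smooth_alg_derive Sf.
Qed.

End SmoothStep.

(** * Weak derivatives and Lipschitz bounds *)

Section WeakDerivative.
Context {R : realType}.
Local Notation mu := (@lebesgue_measure R).
Implicit Types (f g h phi : R -> R) (K : set R) (a b d e L x y : R).

Lemma locally_integrable_compact f K : locally_integrable [set: R] f ->
  compact K -> mu.-integrable K (EFin \o f).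
Proof.
move=> [mf _ foo] cK; apply/integrableP; split; last exact: foo.
by apply/measurable_EFinP; apply: measurable_funS mf.
Qed.

Lemma continuous_locally_integrable f :
  continuous f -> locally_integrable [set: R] f.
Proof.
move=> cf; split; [exact: continuous_measurable_fun|exact: openT|].
move=> K _ cK; have : mu.-integrable K (EFin \o f).
  by apply: continuous_compact_integrable => //; exact: continuous_subspaceT.
by case/integrableP.
Qed.

Lemma locally_integrable_lin a f g :
  locally_integrable [set: R] f -> locally_integrable [set: R] g ->
  locally_integrable [set: R] (fun x => a * f x + g x).
Proof.
move=> lf lg; have [mf oD _] := lf.
apply: (@locally_integrableD _ _ (fun x => a * f x)) => //.
split => //; first exact: measurable_funM.
move=> K _ cK; have : mu.-integrable K (fun x => a%:E * (EFin \o f) x)%E.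
  apply: integrableZl; first exact: compact_measurable.
  exact: locally_integrable_compact.
by case/integrableP.
Qed.

Lemma patch_supp f K : (forall x, ~ K x -> f x = 0) -> f \_ K = f.
Proof.
move=> f0; apply/funext => x; rewrite patchE; case: ifPn => // /negP xK.
by rewrite f0// => Kx; apply: xK; rewrite inE.
Qed.

Lemma Rintegral_supp f K : (forall x, ~ K x -> f x = 0) ->
  Rintegral mu setT f = Rintegral mu K f.
Proof. by move=> f0; rewrite [RHS]Rintegral_mkcond patch_supp. Qed.

Lemma integrable_supp f K : measurable K -> (forall x, ~ K x -> f x = 0) ->
  mu.-integrable K (EFin \o f) -> mu.-integrable setT (EFin \o f).
Proof.
move=> mK f0 fi.
have -> : EFin \o f = (EFin \o f) \_ K by rewrite restrict_EFin patch_supp.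
by apply/integrable_restrict => //; rewrite setTI.
Qed.

(** Both sides of the defining identity of a weak derivative are integrals of
    this form; integrability is needed to split them by linearity. *)
Lemma integrableM_supp f phi K : locally_integrable [set: R] f ->
  continuous phi -> compact K -> (forall x, ~ K x -> phi x = 0) ->
  mu.-integrable K (EFin \o (fun x => f x * phi x)) /\
  mu.-integrable setT (EFin \o (fun x => f x * phi x)).
Proof.
move=> lf cphi cK phi0; have mK := compact_measurable cK.
have iK : mu.-integrable K (EFin \o (fun x => f x * phi x)).
  apply: (@integrableMl _ _ _ mu K mK (EFin \o f) phi).
  - exact: locally_integrable_compact.
  - by apply: measurable_funS (continuous_measurable_fun cphi).
  - have : compact (phi @` K).
      by apply: continuous_compact => //; exact: continuous_subspaceT.
    by move/compact_bounded => [M [Mr hM]]; exists M; split => // y /hM + z Kz; apply; exists z.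
split => //; apply: integrable_supp iK => // x /phi0 ->; exact: mulr0.
Qed.

Lemma test_function_derive1n phi k : test_function phi ->
  continuous (derive1n k phi) /\
  forall x, ~ closure [set x | phi x != 0] x -> derive1n k phi x = 0.
Proof.
move=> [sphi _]; split.
  by move=> x; apply/differentiable_continuous/derivable1_diffP.
elim: k => [x|k IH x Kx].
  by apply: contra_notP => /eqP phix; exact: subset_closure.
rewrite derive1nS derive1E -(derive_cst (0 : R) x 1).
apply: near_eq_derive.
have : nbhs x (~` closure [set x | phi x != 0]).
  by apply: open_nbhs_nbhs; split => //; exact/closed_openC/closed_closure.
by apply: filterS => z; exact: IH.
Qed.

Lemma weak_deriv_cst0 k : weak_deriv k (fun _ : R => 0 : R) (fun _ : R => 0 : R).
Proof.
have l0 : locally_integrable [set: R] (fun _ : R => 0 : R).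
  by apply: continuous_locally_integrable => x; exact: cvg_cst.
split => // phi _.
have -> : (fun x => 0 * derive1n k phi x) = (fun=> 0).
  by apply/funext => x; rewrite mul0r.
have -> : (fun x => 0 * phi x) = (fun=> 0) by apply/funext => x; rewrite mul0r.
by rewrite Rintegral_cst// mul0r mulr0.
Qed.

Lemma weak_deriv_lin k a f1 f2 h1 h2 :
  weak_deriv k f1 h1 -> weak_deriv k f2 h2 ->
  weak_deriv k (fun x => a * f1 x + f2 x) (fun x => a * h1 x + h2 x).
Proof.
move=> [lf1 lh1 e1] [lf2 lh2 e2].
split; [exact: locally_integrable_lin|exact: locally_integrable_lin|].
move=> phi tphi; have [_ cK] := tphi.
have split_int f g j : locally_integrable [set: R] f ->
    locally_integrable [set: R] g ->
  Rintegral mu setT (fun x => (a * f x + g x) * derive1n j phi x) =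
  a * Rintegral mu setT (fun x => f x * derive1n j phi x) +
  Rintegral mu setT (fun x => g x * derive1n j phi x).
  move=> lf lg; have [cphi phi0] := test_function_derive1n j tphi.
  have [_ i1] := integrableM_supp lf cphi cK phi0.
  have [_ i2] := integrableM_supp lg cphi cK phi0.
  rewrite -RintegralZl// -RintegralD//; last first.
    exact: (@integrableZl _ _ _ mu _ measurableT a
    (EFin \o (fun x => f x * derive1n j phi x)) i1).
  by congr Rintegral; apply/funext => x; rewrite mulrDl mulrA.
rewrite split_int// e1// e2// (split_int _ _ 0)//= mulrDr; congr (_ + _).
by rewrite !mulrA (mulrC a).
Qed.

Lemma weak_deriv_sum k (I : finType) (c : I -> R) (f h : I -> R -> R) :
  (forall i, weak_deriv k (f i) (h i)) ->
  weak_deriv k (fun x => \sum_i c i * f i x) (fun x => \sum_i c i * h i x).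
Proof.
move=> fh; elim: (index_enum I) => [|i s IH].
  have -> : (fun x => \sum_(i <- [::]) c i * f i x) = (fun=> 0).
    by apply/funext => x; rewrite big_nil.
  have -> : (fun x => \sum_(i <- [::]) c i * h i x) = (fun=> 0).
    by apply/funext => x; rewrite big_nil.
  exact: weak_deriv_cst0.
have -> : (fun x => \sum_(j <- i :: s) c j * f j x) =
  (fun x => c i * f i x + \sum_(j <- s) c j * f j x).
  by apply/funext => x; rewrite big_cons.
have -> : (fun x => \sum_(j <- i :: s) c j * h j x) =
  (fun x => c i * h i x + \sum_(j <- s) c j * h j x).
  by apply/funext => x; rewrite big_cons.
exact: weak_deriv_lin.
Qed.

(** A smooth step from [0] to [1] over the interval from [a] to [a + d]. Its
    derivative [ramp' a d] has mass one on this interval, so it is an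
    approximate identity at [a] as [d] tends to [0]. *)
Definition ramp (a d x : R) : R := step (d^-1 * x + - (d^-1 * a)).

Definition ramp' (a d x : R) : R := dstep (d^-1 * x + - (d^-1 * a)) * d^-1.

Lemma is_derive_ramp a d x : is_derive x 1 (ramp a d) (ramp' a d x).
Proof.
exact: (@is_derive1_comp R step (fun x => d^-1 * x + - (d^-1 * a)) x _ _
  (is_derive_step _) (is_derive_affine _ _ _)).
Qed.

Lemma continuous_ramp' a d : continuous (ramp' a d).
Proof.
apply: smooth_alg_continuous; apply: (alg_mul _ (alg_cst d^-1)).
by apply: alg_affine; exact: smooth_alg_dstep.
Qed.

Lemma ramp_le a d x : 0 < d -> x <= a -> ramp a d x = 0.
Proof.
by move=> d0 xa; rewrite /ramp step_le0// subr_le0 ler_pM2l ?invr_gt0.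
Qed.

Lemma ramp_ge a d x : 0 < d -> a + d <= x -> ramp a d x = 1.
Proof.
move=> d0 xa; rewrite /ramp step_ge1// -mulrBr -ler_pdivrMl ?invr_gt0//.
by rewrite invrK mulr1 lerBrDl.
Qed.

Lemma ramp'_ge0 a d x : 0 < d -> 0 <= ramp' a d x.
Proof. by move=> d0; rewrite mulr_ge0 ?dstep_ge0// invr_ge0 ltW. Qed.

Lemma ramp'_out a d x : 0 < d -> ~ [set` `[a, a + d]] x -> ramp' a d x = 0.
Proof.
move=> d0; rewrite /= in_itv/= => /negP; rewrite negb_and -!ltNge => xa.
have dr := is_derive_ramp a d x.
rewrite -(@derive_val _ _ _ _ _ _ _ dr).
case/orP: xa => xa.
  rewrite -(derive_cst (0 : R) x 1); apply: near_eq_derive.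
  near=> z; apply: ramp_le => //; apply/ltW.
  by near: z; exact: lt_nbhsl.
rewrite -(derive_cst (1 : R) x 1); apply: near_eq_derive.
near=> z; apply: ramp_ge => //; apply/ltW.
by near: z; exact: lt_nbhsr.
Unshelve. all: by end_near. Qed.

Lemma Rintegral_ramp' a d : 0 < d ->
  Rintegral mu [set` `[a, a + d]] (ramp' a d) = 1.
Proof.
move=> d0; have ad : a < a + d by rewrite ltrDl.
have cr : continuous (ramp a d).
  by move=> x; apply/differentiable_continuous/derivable1_diffP; case: (is_derive_ramp a d x).
rewrite /Rintegral (@continuous_FTC2 _ _ (ramp a d))//.
- by rewrite ramp_ge// ramp_le//= subr0.
- by apply: continuous_subspaceT; exact: continuous_ramp'.
- split.
  + by move=> x _; case: (is_derive_ramp a d x).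
  + exact/cvg_at_right_filter/cr.
  + exact/cvg_at_left_filter/cr.
- by move=> x _; rewrite derive1E (@derive_val _ _ _ _ _ _ _ (is_derive_ramp a d x)).
Qed.

(** Since [ramp' a d] is a probability density on the interval from [a] to
    [a + d], its integral against [f] is a mean of values of [f] close to
    [f a]. *)
Lemma ramp'_average f a d e : continuous f -> 0 < d ->
  (forall x, a <= x <= a + d -> `|f x - f a| <= e) ->
  `|Rintegral mu setT (fun x => f x * ramp' a d x) - f a| <= e.
Proof.
move=> cf d0 fe; have cr := @continuous_ramp' a d.
have cI := @segment_compact _ a (a + d).
have out x : ~ [set` `[a, a + d]] x -> f x * ramp' a d x = 0.
  by move=> /(ramp'_out d0) ->; rewrite mulr0.
have intc (c : R) : mu.-integrable [set` `[a, a + d]] (EFin \o (fun x => c * ramp' a d x)).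
  apply: continuous_compact_integrable => //; apply: continuous_subspaceT => x.
  by apply: cvgM; [exact: cvg_cst|exact: cr].
have intr : mu.-integrable [set` `[a, a + d]] (EFin \o ramp' a d).
  by apply: continuous_compact_integrable => //; exact: continuous_subspaceT.
have valc (c : R) : Rintegral mu [set` `[a, a + d]] (fun x => c * ramp' a d x) = c.
  by rewrite RintegralZl// Rintegral_ramp' ?mulr1.
have intf : mu.-integrable [set` `[a, a + d]] (EFin \o (fun x => f x * ramp' a d x)).
  apply: continuous_compact_integrable => //; apply: continuous_subspaceT => x.
  by apply: cvgM; [exact: cf|exact: cr].
rewrite (Rintegral_supp out) ler_distl; apply/andP; split.
- rewrite -[leLHS]valc; apply: le_Rintegral => // x /=; rewrite in_itv/= => xa.
  rewrite ler_wpM2r ?ramp'_ge0//; have := fe _ xa; rewrite ler_distl; lra.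
- rewrite -[leRHS]valc; apply: le_Rintegral => // x /=; rewrite in_itv/= => xa.
  rewrite ler_wpM2r ?ramp'_ge0//; have := fe _ xa; rewrite ler_distl; lra.
Qed.

(** A smooth substitute for the indicator function of the interval from [a] to
    [b]: testing against it turns the weak derivative into an increment. *)
Definition trapezoid (a b d x : R) : R := ramp a d x - ramp b d x.

Lemma trapezoid_out a b d x : a <= b -> 0 < d ->
  ~ [set` `[a, b + d]] x -> trapezoid a b d x = 0.
Proof.
move=> ab d0; rewrite /= in_itv/= => /negP; rewrite negb_and -!ltNge /trapezoid.
case/orP => xa; first by rewrite !ramp_le ?subrr//; lra.
by rewrite !ramp_ge ?subrr//; lra.
Qed.

Lemma trapezoid_bounds a b d x : a <= b -> 0 < d -> 0 <= trapezoid a b d x <= 1.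
Proof.
move=> ab d0; rewrite /trapezoid subr_ge0 step_homo ?lerD2l ?lerN2 ?ler_pM2l ?invr_gt0//=.
have /andP[_ h1] := step_bounds (d^-1 * x + - (d^-1 * a)).
have /andP[h2 _] := step_bounds (d^-1 * x + - (d^-1 * b)).
by rewrite /ramp; lra.
Qed.

Lemma smooth_alg_trapezoid a b d : smooth_alg (trapezoid a b d).
Proof.
have -> : trapezoid a b d = ramp a d + cst (-1) * ramp b d.
  by apply/funext => x; rewrite -[RHS]/(_ + -1 * _) mulN1r.
apply: alg_add; last apply: alg_mul; first 2 [exact: alg_cst|];
  by apply: alg_affine; exact: smooth_alg_step.
Qed.

Lemma test_function_trapezoid a b d : a <= b -> 0 < d ->
  test_function (trapezoid a b d).
Proof.
move=> ab d0; split; first exact/smooth_alg_smooth/smooth_alg_trapezoid.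
apply: (subclosed_compact _ (@segment_compact _ a (b + d))).
  exact: closed_closure.
rewrite [X in _ `<=` X](closure_id _).1; last exact: interval_closed.
apply: closureS => x /= /eqP; apply: contra_notP.
exact: trapezoid_out.
Qed.

(** Tested against the trapezoid, the integral of [f phi'] is a mean of [f] near
    [a] minus a mean of [f] near [b], while the integral of [h phi] is at most
    [L] times the length of the support of [phi], as [phi] has values in the unit
    interval. *)
Lemma weak_deriv_increment f h L a b d e : 0 <= L -> continuous f -> weak_deriv 1 f h ->
  {ae mu, forall x, `|h x| <= L} -> a <= b -> 0 < d ->
  (forall x, a <= x <= a + d -> `|f x - f a| <= e) ->
  (forall x, b <= x <= b + d -> `|f x - f b| <= e) ->
  `|f a - f b| <= L * (b + d - a) + e + e.
Proof.
move=> L0 cf [_ lh fh] hL ab d0 ea eb.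
have tphi := test_function_trapezoid ab d0.
have cphi := smooth_alg_continuous (@smooth_alg_trapezoid a b d).
set phi := trapezoid a b d in tphi cphi.
pose K := [set` `[a, b + d]].
have cK : compact K := @segment_compact _ a (b + d).
have mK : measurable K := compact_measurable cK.
have phi0 x : ~ K x -> phi x = 0 by exact: trapezoid_out.
have [iK iT] := integrableM_supp lh cphi cK phi0.
have int_h : `|Rintegral mu setT (fun x => h x * phi x)| <= L * (b + d - a).
  rewrite (@Rintegral_supp _ K); last by move=> x /phi0 ->; rewrite mulr0.
  rewrite -lee_fin EFin_normr_Rintegral//.
  have miK := measurable_int _ iK.
  apply: (le_trans (le_abse_integral mu mK miK)).
  have -> : (L * (b + d - a))%:E = (\int[mu]_(x in K) L%:E)%E.
    rewrite integral_cst// [X in (_ * X)%E](_ : _ = (b + d - a)%:E)//.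
    by rewrite [LHS]lebesgue_measure_itv/= lte_fin ifT//; lra.
  apply: ae_ge0_le_integral => //; first exact: measurableT_comp.
  apply: (@filterS _ _ (ae_filter_ringOfSetsType mu) _ _ _ hL) => x hx _ /=; rewrite lee_fin normrM.
  have /andP[p0 p1] := trapezoid_bounds x ab d0.
  rewrite (ger0_norm p0) (le_trans (ler_wpM2l _ p1))// mulr1.
  exact: hx.
have := fh _ tphi; rewrite expr1 mulN1r.
have dphi : derive1n 1 phi = fun x => ramp' a d x - ramp' b d x.
  apply: is_derive1E => z.
  exact: (is_deriveB (is_derive_ramp a d z) (is_derive_ramp b d z)).
have lf := continuous_locally_integrable cf.
have [_ i1] := integrableM_supp lf (@continuous_ramp' a d)
  (@segment_compact _ a (a + d)) (fun x => @ramp'_out a d x d0).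
have [_ i2] := integrableM_supp lf (@continuous_ramp' b d)
  (@segment_compact _ b (b + d)) (fun x => @ramp'_out b d x d0).
have -> : Rintegral mu setT (fun x => f x * derive1n 1 phi x) =
  Rintegral mu setT (fun x => f x * ramp' a d x) -
  Rintegral mu setT (fun x => f x * ramp' b d x).
  rewrite -(RintegralB measurableT i1 i2) dphi.
  by under eq_fun do rewrite mulrBr.
have arith (J I1 I2 fa fb M : R) : `|J| <= M -> I1 - I2 = - J ->
    `|I1 - fa| <= e -> `|I2 - fb| <= e -> `|fa - fb| <= M + e + e.
  rewrite !ler_norml => /andP[J1 J2] IJ /andP[a1 a2] /andP[b1 b2].
  by apply/andP; split; lra.
move=> fhE; apply: (arith _ _ _ _ _ _ int_h fhE).
- exact: ramp'_average.
- exact: ramp'_average.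
Qed.

(** Letting the width [d] of the ramps tend to [0] in [weak_deriv_increment]
    removes the error terms, by continuity of [f] at both points. *)
Lemma weak_deriv_lipschitz f h L : 0 <= L -> continuous f -> weak_deriv 1 f h ->
  {ae mu, forall x, `|h x| <= L} -> forall x y, `|f x - f y| <= L * `|x - y|.
Proof.
move=> L0 cf fh hL x y.
wlog xy : x y / x <= y.
  by move=> H; have [/H//|/ltW/H] := leP x y; rewrite distrC (distrC y).
rewrite (distrC x) (ger0_norm (_ : 0 <= y - x)) ?subr_ge0//.
apply/ler_addgt0Pl => e e0.
have L1 : 0 < L + 1 by rewrite ltr_wpDl.
have e3 : 0 < e / 3 by rewrite divr_gt0.
have near_f z : \forall d \near 0^'+, forall u, z <= u <= z + d -> `|f u - f z| <= e / 3.
  have /cvgrPdist_le/(_ _ e3)[r /= r0 hr] := cf z.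
  near=> d => u /andP[zu ud]; rewrite distrC; apply: hr => /=.
  rewrite distrC ger0_norm ?subr_ge0// ltrBlDl (le_lt_trans ud)// ltrD2l.
  by near: d; exact: nbhs_right_lt.
have [d [d0 dL dx dy]] : exists d, [/\ 0 < d, d <= (e / 3) / (L + 1),
   forall u, x <= u <= x + d -> `|f u - f x| <= e / 3 &
   forall u, y <= u <= y + d -> `|f u - f y| <= e / 3].
  near (0 : R)^'+ => d; exists d; split; near: d.
  - exact: nbhs_right_gt.
  - by apply: nbhs_right_le; rewrite divr_gt0.
  - exact: near_f.
  - exact: near_f.
have := weak_deriv_increment L0 cf fh hL xy d0 dx dy.
have : L * d <= e / 3.
  move: dL; rewrite ler_pdivlMr// mulrC; apply: le_trans.
  by rewrite ler_wpM2r ?lerDl// ltW.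
by rewrite !mulrDr !mulrN; lra.
Unshelve. all: by end_near. Qed.

Lemma Linf_norm_ae (V : normedModType R) (F : R -> V) (M : R) :
  (Linf_norm F <= M%:E)%E -> {ae mu, forall x, `|F x| <= M}.
Proof.
rewrite /Linf_norm Lnorm.unlock.
have -> : (0 < mu [set: R])%E.
  apply: (@lt_le_trans _ _ (mu [set` `[0, 1]])).
    by rewrite lebesgue_measure_itv/= lte_fin ltr01 sube0.
  by apply: le_measure; rewrite ?inE//; exact: measurableT.
move=> /ess_supP; apply: (@filterS _ _ (ae_filter_ringOfSetsType mu)) => x /=.
by rewrite lee_fin normr_id.
Qed.

End WeakDerivative.

(** * Characteristics of the transport equation *)

Section Transport.
Context {R : realType}.
Implicit Types (V : normedModType R) (x t v a b : R).

Lemma within_continuous_comp (T S W : topologicalType) (B : set T) (A : set S)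
    (p : T -> S) (f : S -> W) :
  continuous p -> (forall z, B z -> A (p z)) ->
  {within A, continuous f} -> {within B, continuous (f \o p)}.
Proof.
move=> cp BA /subspace_continuousP cf; apply/subspace_continuousP => z Bz.
apply: cvg_trans (cf _ (BA _ Bz)) => P /= nP.
have : \forall y \near z, A (p y) -> P (f (p y)) by exact: (cp z _ nP).
by apply: filterS => y /[swap] /BA Apy; apply.
Qed.

(** The difference quotient of [F] along the line at time [s] is literally the
    directional difference quotient of [F] in the direction [(a, b)]. *)
Lemma is_derive_line V (F : R * R -> V) (p q a b s : R) :
  differentiable F (p + s * a, q + s * b) ->
  is_derive s 1 (fun r => F (p + r * a, q + r * b))
    ('d F (p + s * a, q + s * b) (a, b)).
Proof.
move=> dF.
have lineE : (fun h => h^-1 *: (F (p + (h *: (1 : R) + s) * a, q + (h *: (1 : R) + s) * b)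
      - F (p + s * a, q + s * b))) =
   (fun h => h^-1 *: (F (h *: (a, b) + (p + s * a, q + s * b))
      - F (p + s * a, q + s * b))).
  apply/funext => h; congr (_ *: (F _ - _)).
  rewrite -[h *: (a, b)]/(h * a, h * b).
  by rewrite -[RHS]/(_ + _, _ + _) /GRing.scale/= mulr1 !mulrDl !addrA ![h * _ + _]addrC.
have dv : derivable F (p + s * a, q + s * b) (a, b) by exact: diff_derivable.
split.
- rewrite /derivable lineE; exact: dv.
- rewrite -deriveE// /derive lineE//.
Qed.

Lemma dx_diff V (u : R -> R -> V) x t :
  differentiable (fun p : R * R => u p.1 p.2) (x, t) ->
  dx u x t = 'd (fun p : R * R => u p.1 p.2) (x, t) (1, 0).
Proof.
move=> du; rewrite /dx derive1E.
have := @is_derive_line V (fun p : R * R => u p.1 p.2) 0 t 1 0 x.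
rewrite mulr1 mulr0 add0r addr0 => /(_ du)[_ <-]; congr ('D_1 _ x).
by apply/funext => r /=; rewrite mulr1 mulr0 add0r addr0.
Qed.

Lemma dt_diff V (u : R -> R -> V) x t :
  differentiable (fun p : R * R => u p.1 p.2) (x, t) ->
  dt u x t = 'd (fun p : R * R => u p.1 p.2) (x, t) (0, 1).
Proof.
move=> du; rewrite /dt derive1E.
have := @is_derive_line V (fun p : R * R => u p.1 p.2) x 0 0 1 t.
rewrite mulr1 mulr0 add0r addr0 => /(_ du)[_ <-]; congr ('D_1 _ t).
by apply/funext => r /=; rewrite mulr1 mulr0 add0r addr0.
Qed.

(** Along the line of slope [v] through [(x, t)] the solution has zero derivative
    at positive times; continuity up to the initial line lets the mean value
    theorem reach time [0]. *)
Lemma transport_characteristics v (u : R -> R -> R) x t :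
  solves_transport v u -> 0 <= t -> u x t = u (x - v * t) 0.
Proof.
move=> [[cu du] eqn]; rewrite le_eqVlt => /predU1P[<-|t0].
  by rewrite mulr0 subr0.
pose F := fun p : R * R => u p.1 p.2.
pose y := x - v * t.
pose h := fun s => F (y + s * v, 0 + s * 1).
have dh s : s \in `]0, t[ -> is_derive s 1 h 0.
  rewrite in_itv/= => /andP[s0 _].
  have dF : differentiable F (y + s * v, 0 + s * 1).
    by apply: du; rewrite add0r mulr1.
  apply: is_derive_eq (is_derive_line dF) _.
  rewrite -[RHS](eqn (y + s * v) (0 + s * 1)) ?add0r ?mulr1//.
  rewrite add0r mulr1 in dF.
  rewrite dx_diff// dt_diff//.
  have -> : (v, 1) = v *: ((1 : R), (0 : R)) + (0, 1) :> R * R.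
    by rewrite -[RHS]/(v * 1 + 0, v * 0 + 1) mulr1 mulr0 addr0 add0r.
  by rewrite linearP addrC.
have ch : {within `[0, t], continuous h}.
  have W := @within_continuous_comp R (R * R)%type R [set` `[0, t]] [set p : R * R | 0 <= p.2]
    (fun s => (y + s * v, 0 + s * 1)) F. 
  apply: W => //.
    move=> s; apply: (@cvg_pair _ _ _ _ (nbhs (y + s * v)) (nbhs (0 + s * 1)));
      (apply: cvgD; first exact: cvg_cst);
      (apply: cvgM; [exact: cvg_id|exact: cvg_cst]).
  by move=> s /=; rewrite in_itv/= add0r mulr1 => /andP[].
have [c _] := MVT t0 dh ch.
rewrite mul0r => /eqP; rewrite subr_eq0 => /eqP.
by rewrite /h /F/= !mul0r !addr0 mulr1 add0r /y mulrC subrK.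
Qed.

Lemma continuous_initial V (u : R -> R -> V) :
  classical_regularity u -> continuous (fun x => u x 0).
Proof.
move=> [cu _] x.
have := @within_continuous_comp _ _ _ setT [set p : R * R | 0 <= p.2]
  (fun x => (x, 0)) (fun p : R * R => u p.1 p.2).
have cp : continuous (fun x : R => (x, 0 : R)).
  by move=> z; apply: (@cvg_pair _ _ _ _ (nbhs z) (nbhs (0 : R)));
    [exact: cvg_id|exact: cvg_cst].
move=> /(_ cp (fun _ _ => lexx 0) cu) /subspace_continuousP /(_ x Logic.I).
by rewrite withinET.
Qed.

Lemma differentiable_mulmx_coord l (k : 'rV[R]_l) (N : 'cV[R]_l) :
  differentiable (fun N : 'cV[R]_l => (k *m N) 0 0 : R) N.
Proof.
have -> : (fun N : 'cV[R]_l => (k *m N) 0 0 : R) =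
   \sum_(j < l) (k 0 j *: (fun N : 'cV[R]_l => N j 0 : R)).
  by apply/funext => M; rewrite mxE fct_sumE.
apply: differentiable_sum => j; apply: differentiableZ.
exact: differentiable_coord.
Qed.

Lemma is_derive_mulmx_coord l (k : 'rV[R]_l) (f : R -> 'cV[R]_l) x :
  derivable f x 1 ->
  is_derive x 1 (fun y => (k *m f y) 0 0 : R) ((k *m 'D_1 f x) 0 0).
Proof.
move=> df.
have -> : (fun y => (k *m f y) 0 0) = \sum_(j < l) (k 0 j *: (fun y => f y j 0 : R)).
  by apply/funext => M; rewrite mxE fct_sumE.
have -> : (k *m 'D_1 f x) 0 0 = \sum_(j < l) k 0 j *: 'D_1 (fun y => f y j 0) x.
  by rewrite derive_mx// mxE; under eq_bigr do rewrite mxE.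
apply: is_derive_sum => j; apply: is_deriveZ.
by split => //; exact: (derivable_mxP _ _ _).1.
Qed.

(** The hypotheses say that [(k, kB)] is a left eigenvector of the matrix of the
    system, with eigenvalue [d]: multiplying the system by it cancels all
    coupling terms. *)
Lemma solves_system_eigenrow l (A : 'M[R]_l) (g c : 'cV[R]_l) (e : R) U B
    (k : 'rV[R]_l) (kB d : R) :
  solves_system A g c e U B ->
  k *m A + (e * kB) *: c^T = d *: k -> (k *m g) 0 0 = d * kB ->
  solves_transport d (fun x t => kB * B x t + (k *m U x t) 0 0).
Proof.
move=> [[cU dU] [cB dB] eqn] kA kg; split; first split.
- move=> p; apply: cvgD; first by apply: cvgM; [exact: cvg_cst|exact: cB].
  apply: (@continuous_comp _ _ _ (fun p : subspace _ => U p.1 p.2)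
    (fun N : 'cV[R]_l => (k *m N) 0 0 : R)); first exact: cU.
  exact/differentiable_continuous/differentiable_mulmx_coord.
- move=> x t t0; apply: differentiableD.
    by apply: differentiableM => //; exact: dB.
  apply: (@differentiable_comp _ _ _ _ (fun p : R * R => U p.1 p.2)
    (fun N : 'cV[R]_l => (k *m N) 0 0 : R)); first exact: dU.
  exact: differentiable_mulmx_coord.
move=> x t t0.
have [eU eB] := eqn x t t0.
have line_der V (u : R -> R -> V) :
    differentiable (fun p : R * R => u p.1 p.2) (x, t) ->
    derivable (fun y => u y t) x 1 /\ derivable (u x) t 1.
  move=> du; split.
    have := @is_derive_line V (fun p : R * R => u p.1 p.2) 0 t 1 0 x.
    rewrite mulr1 mulr0 add0r addr0 => /(_ du)[].
    by under eq_fun do rewrite mulr1 mulr0 add0r addr0.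
  have := @is_derive_line V (fun p : R * R => u p.1 p.2) x 0 0 1 t.
  rewrite mulr1 mulr0 add0r addr0 => /(_ du)[].
  by under eq_fun do rewrite mulr1 mulr0 add0r addr0.
have [Ux Ut] := line_der _ _ (dU x t t0).
have [Bx Bt] := line_der _ _ (dB x t t0).
have comb (f : R -> 'cV[R]_l) (b : R -> R) (s : R) : derivable f s 1 -> derivable b s 1 ->
    derive1 (fun y => kB * b y + (k *m f y) 0 0) s =
    kB * derive1 b s + (k *m derive1 f s) 0 0.
  move=> df db; rewrite !derive1E.
  have db' : is_derive s 1 b ('D_1 b s) by [].
  exact: (@derive_val _ _ _ _ _ _ _
    (is_deriveD (is_deriveZ kB db') (is_derive_mulmx_coord k df))).
have -> : dt (fun x t => kB * B x t + (k *m U x t) 0 0) x t =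
  kB * dt B x t + (k *m dt U x t) 0 0 by exact: (comb (U x) (B x) t Ut Bt).
have -> : dx (fun x t => kB * B x t + (k *m U x t) 0 0) x t =
  kB * dx B x t + (k *m dx U x t) 0 0.
  exact: (comb (fun y => U y t) (fun y => B y t) x Ux Bx).
have -> : dt U x t = - (dx B x t *: g) - A *m dx U x t by rewrite -eU addrK.
have -> : dt B x t = - (e * (c^T *m dx U x t) 0 0).
  by apply/eqP; rewrite -addr_eq0 eB.
rewrite mulmxBr mulmxN -scalemxAr mulmxA.
have -> : k *m A = d *: k - (e * kB) *: c^T by rewrite -kA addrK.
rewrite mulmxBl -!scalemxAl.
move: (k *m g) (k *m dx U x t) (c^T *m dx U x t) kg => G P Q kg.
by rewrite !mxE kg; ring.
Qed.

End Transport.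

(** * Perturbation bounds for the spectral decomposition *)

Section MatrixNorm.
Context {R : realType}.

Lemma mx_entry_le m n (A : 'M[R]_(m, n)) i j : `|A i j| <= `|A|.
Proof.
rewrite [leRHS]/Num.Def.normr/= mx_normrE.
exact: (le_bigmax _ (fun ij : 'I_m * 'I_n => `|A ij.1 ij.2|) (i, j)).
Qed.

Lemma mx_norm_le m n (A : 'M[R]_(m, n)) (M : R) : 0 <= M ->
  (forall i j, `|A i j| <= M) -> `|A| <= M.
Proof.
move=> M0 hA; rewrite [leLHS]/Num.Def.normr/= mx_normrE.
by apply: bigmax_le => // -[i j] _; exact: hA.
Qed.

Lemma mulmx_norm m n p (A : 'M[R]_(m, n)) (B : 'M[R]_(n, p)) :
  `|A *m B| <= n%:R * `|A| * `|B|.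
Proof.
apply: mx_norm_le => [|i j]; first by rewrite !mulr_ge0.
rewrite mxE (le_trans (ler_norm_sum _ _ _))//.
rewrite -mulrA mulr_natl -[X in _ *+ X]card_ord -sumr_const ler_sum// => k _.
by rewrite normrM ler_pM// mx_entry_le.
Qed.

End MatrixNorm.

Section SpectralPerturbation.
Context {R : realType} {l : nat}.
Implicit Types (A X Xh : 'M[R]_l) (g c alphah betah : 'cV[R]_l).

(** The four blocks of the relation [K C = D K]. *)
Lemma diagonalization_rows A X (lambda : 'rV[R]_l) g c Xh alphah betah
    (lambdah : 'rV[R]_l) (thetah mu e : R) :
  let K := K_mx X lambda g Xh alphah betah thetah e in
  let col := invmx (diag_mx lambda) *m X *m g + e *: alphah in
  let D := diag_mx lambda + e *: diag_mx lambdah in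
  K \in unitmx ->
  C_mx A g c e = invmx K *m D_mx lambda lambdah mu e *m K ->
  [/\ (X + e *: Xh) *m A + e *: (col *m c^T) = D *m (X + e *: Xh),
      (X + e *: Xh) *m g = D *m col,
      e *: (betah^T *m A) + (e * (1 + e * thetah)) *: c^T
        = (e * mu) *: (e *: betah^T) &
      e *: (betah^T *m g) = (e * mu * (1 + e * thetah))%:M].
Proof.
move=> K col D Ku CE.
have KC : K *m C_mx A g c e = D_mx lambda lambdah mu e *m K.
  by rewrite CE !mulmxA mulmxV// mul1mx.
move: KC; rewrite /K /K_mx /C_mx /D_mx !mulmx_block => /eq_block_mx[].
rewrite !mul0mx !mulmx0 !addr0 !add0r -/D -/col => e1 e2 e3 e4; split.
- by rewrite -e1 -scalemxAr.
- by rewrite -e2.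
- rewrite -[RHS]mul_scalar_mx -e3 -scalemxAl -!scalemxAr mul_scalar_mx.
  by rewrite scalerA.
- by rewrite scalemxAl e4 -scalar_mxM.
Qed.

(** With [n = 1 + e * thetah], the slow row of [K C = D K] reads
    [betah^T A + n c^T = e mu betah^T] and [betah^T g = mu n]. Multiplying the
    first equation by [A^-1 g] and by [A^-2 g] eliminates [betah] up to second
    order: [n (mu + c^T A^-1 g + e mu c^T A^-2 g) = e^2 mu^2 betah^T A^-2 g].
    Replacing [mu] by [- c^T A^-1 g] in the term of order [e] costs another
    [O(e ^ 2)], and what remains is the definition of [lambdaB1]. The condition
    [e * M <= 1/2] keeps [n] away from [0]. *)
Lemma mu_expansion A g c (M : R) : A \in unitmx ->
  exists2 Cmu : R, 0 <= Cmu & forall (e thetah mu : R) betah,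
  0 < e -> e * M <= 2^-1 -> `|betah| <= M -> `|thetah| <= M -> `|mu| <= M ->
  e *: (betah^T *m A) + (e * (1 + e * thetah)) *: c^T
        = (e * mu) *: (e *: betah^T) ->
  e *: (betah^T *m g) = (e * mu * (1 + e * thetah))%:M ->
  `|mu - lambdaB1 A g c e| <= Cmu * e ^+ 2.
Proof.
move=> Au.
pose q := (c^T *m (invmx A *m invmx A) *m g) 0 0.
pose N1 := l%:R * M * `|invmx A *m g|.
pose N2 := l%:R * M * `|invmx A *m invmx A *m g|.
exists (2 * M ^+ 2 * `|N2| + 2 * `|M| * `|N1| * `|q|).
  apply: addr_ge0; last by rewrite !mulr_ge0.
  by apply: mulr_ge0 => //; apply: mulr_ge0 => //; exact: sqr_ge0.
move=> e thetah mu betah e0 eM hb ht hm row1 row2.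
have M0 : 0 <= M by apply: le_trans hm.
pose n := 1 + e * thetah; pose a := (c^T *m invmx A *m g) 0 0.
pose b1 := (betah^T *m (invmx A *m g)) 0 0.
pose b2 := (betah^T *m (invmx A *m invmx A *m g)) 0 0.
have hbT : `|betah^T| <= M.
  apply: mx_norm_le => // i j; rewrite mxE; exact: le_trans (mx_entry_le _ _ _) hb.
have hb1 : `|b1| <= `|N1|.
  rewrite (le_trans (mx_entry_le _ _ _))// (le_trans (mulmx_norm _ _))//.
  by rewrite (le_trans _ (ler_norm _))// /N1 ler_wpM2r// ler_wpM2l.
have hb2 : `|b2| <= `|N2|.
  rewrite (le_trans (mx_entry_le _ _ _))// (le_trans (mulmx_norm _ _))//.
  by rewrite (le_trans _ (ler_norm _))// /N2 ler_wpM2r// ler_wpM2l.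
have en0 : e != 0 by rewrite gt_eqF.
have n2 : 2^-1 <= n.
  have : `|e * thetah| <= 2^-1.
    by rewrite normrM (gtr0_norm e0) (le_trans _ eM)// ler_wpM2l// ltW.
  by rewrite /n ler_norml; lra.
have row1' : betah^T *m A = (e * mu) *: betah^T - n *: c^T.
  have /(scalerI en0) <- : e *: (betah^T *m A + n *: c^T) =
      e *: ((e * mu) *: betah^T).
    by rewrite scalerDr [in LHS]scalerA row1 !scalerA; congr (_ *: _); ring.
  by rewrite addrK.
have gE : (betah^T *m g) 0 0 = mu * n.
  apply: (mulfI en0); move/(congr1 (fun N : 'M[R]_1 => N 0 0)) : row2.
  by rewrite !mxE eqxx mulr1n mulrA.
have lin (x y : R) (N P : 'M[R]_1) : (x *: N - y *: P) 0 0 = x * N 0 0 - y * P 0 0.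
  by rewrite !mxE.
have eq1 : mu * n = e * mu * b1 - n * a.
  rewrite -gE -[in LHS](mulKVmx Au g) (mulmxA betah^T) row1' mulmxBl -!scalemxAl.
  by rewrite lin /a -mulmxA.
have eq2 : b1 = e * mu * b2 - n * q.
  rewrite {1}/b1 -[in LHS](mulKVmx Au (invmx A *m g)) (mulmxA betah^T).
  by rewrite row1' mulmxBl -!scalemxAl lin /b2 /q -!mulmxA.
have n0 : 0 < n by apply: lt_le_trans n2.
have nn0 : n != 0 by rewrite gt_eqF.
have -> : mu - lambdaB1 A g c e =
   n^-1 * (e ^+ 2 * mu ^+ 2 * b2) - n^-1 * (e ^+ 2 * q * mu * b1).
  rewrite /lambdaB1 /lambdaB0 -/a -/q.
  have -> : a = (e * mu * b1 - mu * n) / n.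
    by apply: (mulIf nn0); rewrite divfK// mulrC; lra.
  have -> : q = (e * mu * b2 - b1) / n.
    by apply: (mulIf nn0); rewrite divfK// mulrC; lra.
  by field.
have nV : n^-1 <= 2 by rewrite -[2]invrK lef_pV2// posrE// invr_gt0.
have nV0 : 0 <= n^-1 by rewrite invr_ge0 ltW.
have e20 : 0 <= e ^+ 2 by exact: sqr_ge0.
have h1 : `|e ^+ 2 * mu ^+ 2 * b2| <= e ^+ 2 * M ^+ 2 * `|N2|.
  rewrite 2!normrM 2!normrX (gtr0_norm e0).
  have hm2 : `|mu| ^+ 2 <= M ^+ 2 by rewrite ler_pXn2r// nnegrE.
  by apply: ler_pM => //; [exact: mulr_ge0 (sqr_ge0 _)|exact: ler_wpM2l].
have h2 : `|e ^+ 2 * q * mu * b1| <= e ^+ 2 * `|q| * M * `|N1|.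
  rewrite 3!normrM normrX (gtr0_norm e0).
  have qe : 0 <= e ^+ 2 * `|q| by exact: mulr_ge0.
  by apply: ler_pM => //; [exact: mulr_ge0|exact: ler_wpM2l].
rewrite (le_trans (ler_normB _ _))// !(normrM n^-1) (ger0_norm nV0).
rewrite (le_trans (lerD (ler_pM nV0 (normr_ge0 _) nV h1)
  (ler_pM nV0 (normr_ge0 _) nV h2)))//.
by rewrite (ger0_norm M0) le_eqVlt; apply/orP; left; apply/eqP; ring.
Qed.

(** The first equation expresses [r] as [- e (r Xh + s betah^T) X^-1], and the
    second one bounds [s] by an affine function of [|r|]. Together they give
    [|r| <= e (P + Q |r|)], and for small [e] the term in [|r|] is absorbed on
    the left. *)
Lemma inverse_last_row_bound X (v : 'cV[R]_l) (M : R) : X \in unitmx -> 0 <= M ->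
  exists Cr e0 : R, [/\ 0 <= Cr, 0 < e0 & forall (e thetah s : R) Xh alphah betah
    (r : 'rV[R]_l),
  0 < e -> e <= e0 -> `|Xh| <= M -> `|alphah| <= M -> `|betah| <= M ->
  `|thetah| <= M ->
  r *m (X + e *: Xh) + s *: (e *: betah^T) = 0 ->
  (r *m (v + e *: alphah)) 0 0 + s * (1 + e * thetah) = 1 ->
  `|r| <= Cr * e].
Proof.
move=> Xu M0.
pose L : R := l%:R.
have L0 : 0 <= L by rewrite ler0n.
pose x := `|invmx X|.
pose P := L * x * (2 * M).
pose Q := L * x * (L * M + 2 * L * M * (`|v| + M)).
have x0 : 0 <= x by exact: normr_ge0.
have P0 : 0 <= P by rewrite !mulr_ge0.
have Q0 : 0 <= Q by rewrite !(mulr_ge0, addr_ge0).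
(* this range of e gives e <= 1, e * M <= 1/2, which keeps 1 + e * thetah away
   from 0, and e * Q <= 1/2, which allows the absorption of Q |r| *)
exists (2 * P); exists (2^-1 / (1 + M + Q)); split.
- by rewrite mulr_ge0.
- by rewrite divr_gt0 ?invr_gt0// ltr_wpDr// ltr_wpDr.
move=> e thetah s Xh alphah betah r e0 ee0 hX ha hb ht eq1 eq2.
have S0 : 0 < 1 + M + Q by rewrite ltr_wpDr// ltr_wpDr.
move: ee0; rewrite ler_pdivlMr// !mulrDr mulr1 => ee0.
have eM0 : 0 <= e * M by rewrite mulr_ge0// ltW.
have eQ0 : 0 <= e * Q by rewrite mulr_ge0// ltW.
have hbT : `|betah^T| <= M.
  apply: mx_norm_le => // i j; rewrite mxE; exact: le_trans (mx_entry_le _ _ _) hb.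
have hs : `|s| <= 2 * (1 + L * `|r| * (`|v| + M)).
  have hth : `|e * thetah| <= 2^-1.
    rewrite normrM (gtr0_norm e0); apply: (@le_trans _ _ (e * M)); last lra.
    by rewrite ler_wpM2l// ltW.
  have hva : `|v + e *: alphah| <= `|v| + M.
    rewrite (le_trans (ler_normD _ _))// lerD2l normrZ (gtr0_norm e0).
    by rewrite -[leRHS]mul1r ler_pM// ?(ltW e0)//; lra.
  have hrv : `|(r *m (v + e *: alphah)) 0 0| <= L * `|r| * (`|v| + M).
    rewrite (le_trans (mx_entry_le _ _ _))// (le_trans (mulmx_norm _ _))//.
    by rewrite ler_wpM2l// mulr_ge0.
  have hsn : `|s| * 2^-1 <= 1 + L * `|r| * (`|v| + M).
    have -> : 1 + L * `|r| * (`|v| + M) = `|1| + L * `|r| * (`|v| + M) by rewrite normr1.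
    apply: (@le_trans _ _ `|s * (1 + e * thetah)|).
      rewrite normrM ler_wpM2l//; move: hth; rewrite ler_norml => /andP[? ?].
      by rewrite ger0_norm; lra.
    have -> : s * (1 + e * thetah) = 1 - (r *m (v + e *: alphah)) 0 0.
      by apply/eqP; rewrite eq_sym subr_eq addrC eq2.
    by rewrite (le_trans (ler_normB _ _))// lerD2l.
  by lra.
have rE : r = - (e *: ((r *m Xh + s *: betah^T) *m invmx X)).
  rewrite -[LHS](mulmxK Xu) scalemxAl -mulNmx; congr (_ *m _).
  apply/eqP; rewrite -addr_eq0 scalerDr addrA; apply/eqP.
  rewrite -[RHS]eq1 mulmxDr -scalemxAr; congr (_ + _).
  by rewrite !scalerA mulrC.
have hr : `|r| <= e * (P + Q * `|r|).
  rewrite {1}rE normrN normrZ (gtr0_norm e0) ler_wpM2l ?(ltW e0)//.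
  rewrite (le_trans (mulmx_norm _ _))// -/L -/x.
  have : `|r *m Xh + s *: betah^T| <= L * `|r| * M + `|s| * M.
    rewrite (le_trans (ler_normD _ _))// lerD//.
      by rewrite (le_trans (mulmx_norm _ _))// ler_wpM2l// mulr_ge0.
    by rewrite normrZ ler_wpM2l.
  have : `|s| * M <= 2 * (1 + L * `|r| * (`|v| + M)) * M by rewrite ler_wpM2r.
  move=> h1 h2.
  have h3 := le_trans h2 (lerD (lexx _) h1).
  rewrite mulrAC (le_trans (ler_wpM2l (mulr_ge0 L0 x0) h3))//.
  by rewrite le_eqVlt; apply/orP; left; apply/eqP; rewrite /P /Q; ring.
have : e * (Q * `|r|) <= 2^-1 * `|r|.
  by rewrite mulrA ler_wpM2r//; lra.
by move: hr; rewrite mulrDr; lra.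
Qed.

End SpectralPerturbation.

(** * Drift of the slow variable *)

Section SlowVariable.
Context {R : realType} {l : nat}.
Implicit Types (A X Xh : 'M[R]_l) (g c : 'cV[R]_l) (U : R -> R -> 'cV[R]_l).
Implicit Types (B : R -> R -> R).

(** The row [(r, s)] recovers the last unknown from its combinations with the
    rows of the block matrix. *)
Lemma inverse_last_row (K1 : 'M[R]_l) (K2 : 'cV[R]_l) (K3 : 'rV[R]_l) (n : R) :
  block_mx K1 K2 K3 n%:M \in unitmx ->
  exists (r : 'rV[R]_l) (s : R),
    r *m K1 + s *: K3 = 0 /\ (r *m K2) 0 0 + s * n = 1.
Proof.
move=> Ku; have := mulVmx Ku.
rewrite -[invmx _]submxK mulmx_block scalar_mx_block => /eq_block_mx[_ _ h3 h4].
exists (dlsubmx (invmx (block_mx K1 K2 K3 n%:M))).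
exists (drsubmx (invmx (block_mx K1 K2 K3 n%:M)) 0 0).
split.
  by rewrite -[RHS]h3 [X in _ = _ + X *m _]mx11_scalar mul_scalar_mx.
move: h4; rewrite [X in _ + X *m _]mx11_scalar -scalar_mxM.
move/matrixP/(_ 0 0); rewrite [LHS]mxE [X in _ + X]mxE [RHS]mxE eqxx !mulr1n.
by [].
Qed.

Lemma weak_deriv_combination (U0 U0x : R -> 'cV[R]_l) (B0 B0x : R -> R)
    (k : 'rV[R]_l) (kB : R) :
  (forall i, weak_deriv 1 (fun x => U0 x i 0) (fun x => U0x x i 0)) ->
  weak_deriv 1 B0 B0x ->
  weak_deriv 1 (fun x => kB * B0 x + (k *m U0 x) 0 0)
               (fun x => kB * B0x x + (k *m U0x x) 0 0).
Proof.
move=> hU hB; apply: weak_deriv_lin => //.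
have mulE (N : R -> 'cV[R]_l) : (fun x => (k *m N x) 0 0) =
    (fun x => \sum_j k 0 j * N x j 0) by apply/funext => x; rewrite mxE.
rewrite !mulE.
exact: (@weak_deriv_sum _ 1 'I_l (k 0) (fun j x => U0 x j 0) (fun j x => U0x x j 0)).
Qed.

(** [B] is [r] times the fast components plus [s] times the slow one. Moving along
    the slow characteristic leaves the slow contribution unchanged, so that only
    the fast ones, evaluated at points at distance [|d i - sigma| * t], make [B]
    vary. *)
Lemma slow_variable_drift U B (k : 'M[R]_l) (col : 'cV[R]_l) (kS : 'rV[R]_l)
    (nS : R) (d : 'I_l -> R) (sigma : R) (r : 'rV[R]_l) (s : R) (Lw V : R) :
  (forall i, solves_transport (d i)
     (fun x t => col i 0 * B x t + (row i k *m U x t) 0 0)) ->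
  solves_transport sigma (fun x t => nS * B x t + (kS *m U x t) 0 0) ->
  r *m k + s *: kS = 0 -> (r *m col) 0 0 + s * nS = 1 ->
  0 <= Lw ->
  (forall i x y, `|(col i 0 * B x 0 + (row i k *m U x 0) 0 0)
      - (col i 0 * B y 0 + (row i k *m U y 0) 0 0)| <= Lw * `|x - y|) ->
  (forall i, `|d i - sigma| <= V) ->
  forall x t, 0 <= t ->
  `|B x t - B (x - sigma * t) 0| <= l%:R * (`|r| * (Lw * (V * t))).
Proof.
move=> hf hs rk rc L0 hL hV x t t0.
pose w i x t := col i 0 * B x t + (row i k *m U x t) 0 0.
pose ws x t := nS * B x t + (kS *m U x t) 0 0.
(* the coefficients of U cancel by rk and those of B add up to 1 by rc *)
have BE y u : B y u = \sum_i r 0 i * w i y u + s * ws y u.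
  have -> : \sum_i r 0 i * w i y u =
      (r *m col) 0 0 * B y u + (r *m k *m U y u) 0 0.
    rewrite [in X in X * _]mxE mulr_suml -mulmxA [X in _ + X]mxE -big_split/=.
    apply: eq_bigr => i _; rewrite /w mulrDr mulrA; congr (_ + _ * _).
    by rewrite -row_mul mxE.
  have -> : r *m k = - (s *: kS) by apply/eqP; rewrite -addr_eq0 rk.
  rewrite mulNmx -scalemxAl /ws.
  move: (kS *m U y u) ((r *m col) 0 0) rc => N z zE; rewrite !mxE mulrDr.
  have -> : z = 1 - s * nS by rewrite -zE addrK.
  ring.
have wE i : w i x t = w i (x - d i * t) 0.
  exact: (transport_characteristics x (hf i) t0).
have wsE : ws x t = ws (x - sigma * t) 0.
  exact: (transport_characteristics x hs t0).
rewrite (BE x t) (BE (x - sigma * t) 0) wsE.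
rewrite opprD addrACA subrr addr0 -sumrB.
rewrite (le_trans (ler_norm_sum _ _ _))//.
rewrite mulr_natl -[X in _ *+ X]card_ord -sumr_const ler_sum// => i _.
rewrite -mulrBr normrM ler_pM// ?mx_entry_le// wE.
rewrite (le_trans (hL _ _ _))// ler_wpM2l//.
have -> : x - d i * t - (x - sigma * t) = - ((d i - sigma) * t) by ring.
by rewrite normrN normrM (ger0_norm t0) ler_wpM2r.
Qed.

Lemma diag_mx_unit (lambda : 'rV[R]_l) :
  (forall i, lambda 0 i != 0) -> diag_mx lambda \in unitmx.
Proof.
by move=> h; rewrite unitmxE det_diag unitfE; apply/prodf_neq0 => i _; exact: h.
Qed.

(** The left-hand side is the slope of the fast components; the vector on the
    right is the one that the first condition on the initial data makes
    [O(e ^ 2)]. *)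
Lemma fast_slope_factor A X (lambda : 'rV[R]_l) g Xh (alphah : 'cV[R]_l) e
    (u : 'cV[R]_l) (b : R) :
  X \in unitmx -> diag_mx lambda \in unitmx ->
  A = invmx X *m diag_mx lambda *m X ->
  (X + e *: Xh) *m u + b *: (invmx (diag_mx lambda) *m X *m g + e *: alphah) =
  invmx (diag_mx lambda) *m X *m
    ((A + e *: (invmx X *m diag_mx lambda *m Xh)) *m u
     + b *: (g + e *: (invmx X *m diag_mx lambda *m alphah))).
Proof.
move=> Xu Lu ->.
have cancel m (N : 'M[R]_(l, m)) :
    invmx (diag_mx lambda) *m X *m (invmx X *m diag_mx lambda *m N) = N.
  by rewrite !mulmxA mulmxK// mulVmx// mul1mx.
rewrite mulmxDr -scalemxAr mulmxDr -scalemxAr cancel; congr (_ + _).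
rewrite mulmxA; congr (_ *m _).
by rewrite mulmxDr -scalemxAr !cancel.
Qed.

End SlowVariable.

(** * Comparison with the first order model *)

Section Diagonalized.
Context {R : realType} {l : nat}.
Implicit Types (A X Xh : 'M[R]_l) (g c col : 'cV[R]_l).
Implicit Types (U : R -> R -> 'cV[R]_l) (B : R -> R -> R).

Lemma fast_component_transport A g c e U B (K1 : 'M[R]_l) col (d : 'rV[R]_l) i :
  solves_system A g c e U B ->
  K1 *m A + e *: (col *m c^T) = diag_mx d *m K1 ->
  K1 *m g = diag_mx d *m col ->
  solves_transport (d 0 i)
    (fun x t => col i 0 * B x t + (row i K1 *m U x t) 0 0).
Proof.
move=> sol e1 e2; apply: (solves_system_eigenrow sol).
  apply/rowP => j; move/matrixP/(_ i j) : e1.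
  rewrite mul_diag_mx -row_mul; move: (K1 *m A) => N.
  by rewrite !mxE big_ord1 !mxE mulrA.
by rewrite -row_mul e2 mul_diag_mx !mxE.
Qed.

Lemma slow_component_transport A g c e U B (betah : 'cV[R]_l) n mu :
  solves_system A g c e U B ->
  e *: (betah^T *m A) + (e * n) *: c^T = (e * mu) *: (e *: betah^T) ->
  e *: (betah^T *m g) = (e * mu * n)%:M ->
  solves_transport (e * mu)
    (fun x t => n * B x t + ((e *: betah^T) *m U x t) 0 0).
Proof.
move=> sol e3 e4; apply: (solves_system_eigenrow sol).
  by rewrite -scalemxAl.
by rewrite -scalemxAl e4 mxE eqxx mulr1n.
Qed.

End Diagonalized.

Lemma sobolev_inf_first_deriv (R : realType) (m : nat) (f : R -> R) (M : R) :
  (0 < m)%N -> sobolev_inf_norm_le m f M ->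
  exists2 h, weak_deriv 1 f h &
    {ae (@lebesgue_measure R), forall x, `|h x| <= M}.
Proof.
move=> m0 [d dw dM]; exists (d 1%N); first exact: dw.
apply: Linf_norm_ae; apply: le_trans dM.
have m1 : (1 < m.+1)%N by rewrite ltnS.
rewrite (bigD1 (Ordinal m1))//= leeDl// sume_ge0// => i _.
exact: Lnorm_ge0.
Qed.

Theorem theorem2p1 (R : realType) (l : nat)
  (A X : 'M[R]_l) (lambda : 'rV[R]_l) (delta : R) (g c : 'cV[R]_l)
  (hA : simple_real_spectrum A lambda)
  (hdelta : 0 < delta)
  (hlambda : forall i : 'I_l, delta < `|lambda 0 i|)
  (hX : X \in unitmx)
  (hAX : A = invmx X *m diag_mx lambda *m X)
  (* bounded corrections in the diagonalization of C^e, for small e *)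
  (Xh : R -> 'M[R]_l) (alphah betah : R -> 'cV[R]_l) (lambdah : R -> 'rV[R]_l)
  (thetah mu : R -> R)
  (hbounded : exists M : R, \forall e \near 0^'+,
    [/\ `|Xh e| <= M, `|alphah e| <= M & `|betah e| <= M] /\
    [/\ `|thetah e| <= M, `|mu e| <= M & `|lambdah e| <= M])
  (hdiag : \forall e \near 0^'+,
    let K := K_mx X lambda g (Xh e) (alphah e) (betah e) (thetah e) e in
    K \in unitmx /\
    C_mx A g c e = invmx K *m D_mx lambda (lambdah e) (mu e) e *m K)
  (* the solutions, depending on e *)
  (U : R -> R -> R -> 'cV[R]_l) (B B1 : R -> R -> R -> R)
  (hUB : \forall e \near 0^'+, solves_system A g c e (U e) (B e))
  (hB1 : \forall e \near 0^'+,
    solves_transport (e * lambdaB1 A g c e) (B1 e))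
  (* U0x e, U0xx e, B0x e, B0xx e: first and second derivatives of
     U(., 0) and B(., 0) *)
  (U0x U0xx : R -> R -> 'cV[R]_l) (B0x B0xx : R -> R -> R)
  (hU0 : \forall e \near 0^'+, forall i : 'I_l,
    weak_deriv 1 (fun x => U e x 0 i 0) (fun x => U0x e x i 0) /\
    weak_deriv 2 (fun x => U e x 0 i 0) (fun x => U0xx e x i 0))
  (hB0 : \forall e \near 0^'+,
    weak_deriv 1 (fun x => B e x 0) (B0x e) /\
    weak_deriv 2 (fun x => B e x 0) (B0xx e))
  (hinit1 : Linf_bigO (fun e x =>
    (A + e *: (invmx X *m diag_mx lambda *m Xh e)) *m U0x e x
    + B0x e x *: (g + e *: (invmx X *m diag_mx lambda *m alphah e))) 2)
  (hinit2 : Linf_bigO (fun e x => A *m U0xx e x + B0xx e x *: g) 1)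
  (hinit3 : \forall e \near 0^'+, forall x : R, B1 e x 0 = B e x 0)
  (hsobolev : exists M : R, \forall e \near 0^'+,
    sobolev_inf_norm_le 2 (fun x => B e x 0) M) :
  forall T : R, 0 < T ->
  exists C : R, \forall e \near 0^'+, forall t : R, 0 <= t <= T / e ->
    (sup_norm (fun x => (B e x t - B1 e x t)%R) <= (C * e ^+ 2)%:E)%E.
Proof.
move=> T T0.
have [M hM] := hbounded; have [C1 hC1] := hinit1; have [Ms hMs] := hsobolev.
have lam0 i : lambda 0 i != 0 by rewrite -normr_gt0 (lt_trans hdelta).
have Lu := diag_mx_unit lam0.
have Au : A \in unitmx by rewrite hAX !unitmx_mul unitmx_inv hX Lu.
pose v := invmx (diag_mx lambda) *m X *m g.
have [Cr [e0 [Cr0 e00 hCr]]] := inverse_last_row_bound v hX (normr_ge0 M).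
have [Cmu Cmu0 hCmu] := mu_expansion g c `|M| Au.
pose Gc := l%:R * `|invmx (diag_mx lambda) *m X| * `|C1|.
pose V := `|lambda| + 2 * `|M|.
have Gc0 : 0 <= Gc by rewrite !mulr_ge0.
have V0 : 0 <= V by rewrite addr_ge0// mulr_ge0.
exists (l%:R * Cr * Gc * V * T + `|Ms| * Cmu * T).
near=> e.
have ep : 0 < e by near: e; exact: nbhs_right_gt.
have e1 : e <= 1 by near: e; exact: nbhs_right_le.
have ee0 : e <= e0 by near: e; exact: nbhs_right_le.
have eM : e * `|M| <= 2^-1.
  apply: (@le_trans _ _ (e * (`|M| + 1))); first by rewrite ler_wpM2l ?lerDl// ltW.
  rewrite -ler_pdivlMr ?ltr_wpDl//; near: e; apply: nbhs_right_le.
  by rewrite divr_gt0// ?invr_gt0// ltr_wpDl.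
have bnd : [/\ `|Xh e| <= M, `|alphah e| <= M & `|betah e| <= M] /\
  [/\ `|thetah e| <= M, `|mu e| <= M & `|lambdah e| <= M] by near: e.
have {bnd} [[bX ba bb] [bt bm bl]] : [/\ `|Xh e| <= `|M|, `|alphah e| <= `|M| & `|betah e| <= `|M|] /\
  [/\ `|thetah e| <= `|M|, `|mu e| <= `|M| & `|lambdah e| <= `|M|].
  by case: bnd => [[? ? ?] [? ? ?]]; split; split; apply: le_trans (ler_norm M).
have diag : let K := K_mx X lambda g (Xh e) (alphah e) (betah e) (thetah e) e in
    K \in unitmx /\
    C_mx A g c e = invmx K *m D_mx lambda (lambdah e) (mu e) e *m K by near: e.
have sol : solves_system A g c e (U e) (B e) by near: e.
have sol1 : solves_transport (e * lambdaB1 A g c e) (B1 e) by near: e.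
have dU : forall i : 'I_l,
    weak_deriv 1 (fun x => U e x 0 i 0) (fun x => U0x e x i 0) /\
    weak_deriv 2 (fun x => U e x 0 i 0) (fun x => U0xx e x i 0) by near: e.
have [dB _] : weak_deriv 1 (fun x => B e x 0) (B0x e) /\
    weak_deriv 2 (fun x => B e x 0) (B0xx e) by near: e.
have in1 : (Linf_norm (fun x => (
    (A + e *: (invmx X *m diag_mx lambda *m Xh e)) *m U0x e x
    + B0x e x *: (g + e *: (invmx X *m diag_mx lambda *m alphah e)))%R)
    <= (C1 * e ^+ 2)%:E)%E by near: e.
have in3 : forall x, B1 e x 0 = B e x 0 by near: e.
have sob : sobolev_inf_norm_le 2 (fun x => B e x 0) Ms by near: e.
move=> t /andP[t0 tT].
have [Ku CE] := diag.
have [r1 r2 r3 r4] := diagonalization_rows Ku CE.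
have [r [s [rk rc]]] := inverse_last_row Ku.
set K1 := X + e *: Xh e in r1 r2 rk.
set col := invmx (diag_mx lambda) *m X *m g + e *: alphah e in r1 r2 rc.
have DE : diag_mx lambda + e *: diag_mx (lambdah e) =
    diag_mx (lambda + e *: lambdah e) by rewrite linearD linearZ.
rewrite DE in r1 r2.
have fast i := fast_component_transport i sol r1 r2.
have slow := slow_component_transport sol r3 r4.
have [_ regB _] := sol.
have hr : `|r| <= Cr * e.
  exact: (hCr e (thetah e) s (Xh e) (alphah e) (betah e)).
have hmu : `|mu e - lambdaB1 A g c e| <= Cmu * e ^+ 2.
  exact: (hCmu e (thetah e) (mu e) (betah e)).
have e20 : 0 <= e ^+ 2 by exact: sqr_ge0.
(* slopes of order e ^ 2 for the initial fast components *)
have fastL i x y :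
  `|(col i 0 * B e x 0 + (row i K1 *m U e x 0) 0 0)
    - (col i 0 * B e y 0 + (row i K1 *m U e y 0) 0 0)| <= Gc * e ^+ 2 * `|x - y|.
  apply: (@weak_deriv_lipschitz R
    (fun x => col i 0 * B e x 0 + (row i K1 *m U e x 0) 0 0)
    (fun x => col i 0 * B0x e x + (row i K1 *m U0x e x) 0 0)).
  - exact: mulr_ge0.
  - exact: (continuous_initial (fast i).1).
  - by apply: weak_deriv_combination => // j; exact: (dU j).1.
  - apply: (@filterS _ _ (ae_filter_ringOfSetsType lebesgue_measure) _ _ _
      (Linf_norm_ae in1)) => z hz.
    have -> : col i 0 * B0x e z + (row i K1 *m U0x e z) 0 0 =
        (K1 *m U0x e z + B0x e z *: col) i 0.
      rewrite -row_mul [(row i _) 0 0]mxE [RHS]mxE [X in _ = _ + X]mxE.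
      by rewrite addrC [in LHS]mulrC.
    rewrite (fast_slope_factor _ _ _ _ _ _ hX Lu hAX).
    rewrite (le_trans (mx_entry_le _ _ _))// (le_trans (mulmx_norm _ _))//.
    rewrite /Gc -[leRHS]mulrA ler_wpM2l// ?mulr_ge0//.
    by rewrite (le_trans hz)// ler_wpM2r// ler_norm.
(* on the range e <= 1 all relative speeds are bounded by V *)
have hV i : `|(lambda + e *: lambdah e) 0 i - e * mu e| <= V.
  rewrite !mxE (le_trans (ler_normB _ _))// !(normrM e) (gtr0_norm ep).
  have h1 : `|lambda 0 i + e * lambdah e 0 i| <= `|lambda| + `|M|.
    rewrite (le_trans (ler_normD _ _))// lerD ?mx_entry_le//.
    rewrite normrM (gtr0_norm ep) -[leRHS]mul1r ler_pM// ?(ltW ep)//.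
    exact: le_trans (mx_entry_le _ _ _) bl.
  have h2 : e * `|mu e| <= `|M|.
    by rewrite -[leRHS]mul1r ler_pM// ltW.
  by rewrite (le_trans (lerD h1 h2))// /V mulr_natl mulr2n addrA.
apply: ge_ereal_sup => _ [x _ <-]; rewrite lee_fin.
have drift := slow_variable_drift fast slow rk rc (mulr_ge0 Gc0 e20) fastL hV x t0.
have [h dh hh] := sobolev_inf_first_deriv (isT : (0 < 2)%N) sob.
have lipB : forall x y, `|B e x 0 - B e y 0| <= `|Ms| * `|x - y|.
  apply: (weak_deriv_lipschitz (normr_ge0 _) (continuous_initial regB) dh).
  apply: (@filterS _ _ (ae_filter_ringOfSetsType lebesgue_measure) _ _ _ hh) => z.
  by move/le_trans; apply; exact: ler_norm.
have B1E : B1 e x t = B e (x - e * lambdaB1 A g c e * t) 0.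
  by rewrite (transport_characteristics x sol1 t0) in3.
have et : e * t <= T by rewrite mulrC -ler_pdivlMr.
have et0 : 0 <= e * t by rewrite mulr_ge0// ltW.
(* the intermediate point is the foot of the exact slow characteristic *)
rewrite B1E -(subrKA (B e (x - e * mu e * t) 0)) (le_trans (ler_normD _ _))//.
rewrite mulrDl; apply: lerD.
  rewrite (le_trans drift)//.
  have -> : l%:R * Cr * Gc * V * T * e ^+ 2 =
    l%:R * (Cr * Gc * V * e ^+ 2) * T by ring.
  apply: (@le_trans _ _ (l%:R * (Cr * e * (Gc * e ^+ 2 * (V * t))))).
    by rewrite ler_wpM2l// ler_wpM2r// !mulr_ge0.
  have -> : l%:R * (Cr * e * (Gc * e ^+ 2 * (V * t))) =
    l%:R * (Cr * Gc * V * e ^+ 2) * (e * t) by ring.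
  by rewrite ler_wpM2l// !mulr_ge0// ltW.
rewrite (le_trans (lipB _ _))//.
have -> : x - e * mu e * t - (x - e * lambdaB1 A g c e * t) =
  - ((mu e - lambdaB1 A g c e) * (e * t)) by ring.
rewrite normrN normrM (ger0_norm et0) -!mulrA ler_wpM2l//.
have -> : Cmu * (T * e ^+ 2) = Cmu * e ^+ 2 * T by ring.
by rewrite ler_pM.
Unshelve. all: by end_near. Qed.
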